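(* Assume $c=1$, i.e. $a^{ij}b_ib_j=-1$. For $y_1,y_2\in T_xM$ both in the future-time-like sector define $$\alpha_{\{x\}}(y_1,y_2)=\frac1h\operatorname{arccosh}\frac{h^2\,r_{ij}y_1^iy_2^j-A(x,y_1)A(x,y_2)}{\sqrt{|B(x,y_1)|}\sqrt{|B(x,y_2)|}},$$ and for $y_1,y_2$ both in the space-like sector define $$\alpha_{\{x\}}(y_1,y_2)=\frac1h\arccos\frac{A(x,y_1)A(x,y_2)-h^2\,r_{ij}y_1^iy_2^j}{\sqrt{|B(x,y_1)|}\sqrt{|B(x,y_2)|}}$$ (whenever the argument of $\arccos$ lies in $[-1,1]$), where $A=b+\frac12gq$. Let $$\zeta^m(x,y)=\Bigl[h\,v^m-\bigl(b+\tfrac12 g q\bigr)b^m\Bigr]\frac{J}{\varkappa h},\quad v^m=y^m+b\,b^m,\quad \varkappa=\frac1h|F^2|^{(1-h)/2},\quad S^2(\zeta)=a_{ij}(x)\zeta^i\zeta^j .$$ Then $$\alpha_{\{x\}}(y_1,y_2)=\frac1h\,\alpha_{\text{pseudo-Riemannian}},$$ where, with $\zeta_1=\zeta(x,y_1)$ and $\zeta_2=\zeta(x,y_2)$, $$\alpha_{\text{pseudo-Riemannian}}=\operatorname{arccosh}\frac{a_{mn}\zeta_1^m\zeta_2^n}{\sqrt{S^2(\zeta_1)}\sqrt{S^2(\zeta_2)}}\ \ (\epsilon=1),\qquad \alpha_{\text{pseudo-Riemannian}}=\arccos\frac{-a_{mn}\zeta_1^m\zeta_2^n}{\sqrt{|S^2(\zeta_1)|}\sqrt{|S^2(\zeta_2)|}}\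 \ (\epsilon=-1).$$
   Context: Let $M$ be an $N$-dimensional smooth manifold with a pseudo-Riemannian metric tensor $a_{ij}(x)$ of signature $(+,-,\dots,-)$ and inverse $a^{ij}$, a 1-form $b_i(x)$ with $a^{ij}b_ib_j=-1$, and a scalar field $g(x)$. Put $b^i=a^{ij}b_j$. For $y\in T_xM$ put $$b=b_i(x)y^i,\quad r_{ij}=a_{ij}+b_ib_j,\quad \gamma=r_{ij}y^iy^j,\quad q=\sqrt{|\gamma|},\quad B=\gamma-g\,b\,q-b^2 .$$ Future-time-like sector ($\epsilon=1$, any real $g$): one fixed (future) connected component of the set of $y$ with $\gamma>0$ and $B>0$. There $h=\sqrt{1+g^2/4}$, $G=g/h$, $g_\pm=-\frac12g\pm h$, $B=(b-g_-q)(g_+q-b)$ and $J=\left(\frac{b-g_-q}{g_+q-b}\right)^{-G/4}$. Space-like sector ($\epsilon=-1$, $-2<g<2$): the $y$ with $\gamma<0$ (so $B=-(q^2+gbq+b^2)<0$). There $h=\sqrt{1-g^2/4}$, $G=g/h$, $L=q+\frac g2 b$, $J=e^{-\frac12 G f}$ with $f=-\arctan\frac G2+\arctan\frac{L}{hb}$ if $b<0$, $f=-\pi-\arctan\frac G2+\arctan\frac{L}{hb}$ if $b>0$ and, by continuity, $f=-\frac\pi2-\arctan\frac G2$ if $b=0$. In both sectors $F^2=BJ^2$. *)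

(* Defs.v *)
From HB Require Import structures.
From mathcomp Require Import all_boot all_order all_algebra.
From mathcomp Require Import all_classical all_reals all_analysis.

Set Implicit Arguments.
Unset Strict Implicit.
Unset Printing Implicit Defensive.

Import Order.TTheory GRing.Theory Num.Theory.
Import numFieldNormedType.Exports.

Local Open Scope classical_set_scope.
Local Open Scope ring_scope.

(* f is C^k on U, by iterated partial derivatives; meant for U open in R^N. *)
Fixpoint class_C (R : realType) (N k : nat) (U : set 'rV[R]_N)
    (f : 'rV[R]_N -> R) : Prop :=
  (forall u, U u -> {for u, continuous f}) /\
  if k is k'.+1 then
    forall i : 'I_N,
      (forall u, U u -> derivable f u (delta_mx 0 i)) /\
      class_C k' U ('D_(delta_mx 0 i) f)
  else True.

Definition smooth_on (R : realType) (N : nat) (U : set 'rV[R]_N)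
    (f : 'rV[R]_N -> R) : Prop := forall k, class_C k U f.

(* Only the restrictions of [chart c] to [chart_dom c] and of [chart_inv c] to
   the image of that domain are meaningful. *)
Record smooth_atlas (R : realType) (N : nat) (M : topologicalType) := SmoothAtlas {
  chart_index : Type ;
  chart_dom : chart_index -> set M ;
  chart : chart_index -> M -> 'rV[R]_N ;
  chart_inv : chart_index -> 'rV[R]_N -> M ;
  chart_dom_open : forall c, open (chart_dom c) ;
  chart_dom_cover : forall x, exists c, chart_dom c x ;
  chart_image_open : forall c, open (chart c @` chart_dom c) ;
  chart_continuous : forall c x, chart_dom c x -> {for x, continuous (chart c)} ;
  chart_inv_continuous : forall c u, (chart c @` chart_dom c) u ->
    {for u, continuous (chart_inv c)} ;
  chartK : forall c x, chart_dom c x -> chart_inv c (chart c x) = x ;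
  chart_transition_smooth : forall c d (j : 'I_N),
    smooth_on (chart c @` (chart_dom c `&` chart_dom d))
              (fun u => chart d (chart_inv c u) 0 j)
}.

(* The matrix of the partial derivatives d x_d^k / d x_c^i at x; rows are
   indexed by i, columns by k. *)
Definition transition_partials (R : realType) (N : nat) (M : topologicalType)
    (S : smooth_atlas R N M) (c d : chart_index S) (x : M) : 'M[R]_N :=
  \matrix_(i, k) 'D_(delta_mx 0 i)
    (fun u => chart d (chart_inv c u) 0 k) (chart c x).

Definition smooth_scalar (R : realType) (N : nat) (M : topologicalType)
    (S : smooth_atlas R N M) (g : M -> R) : Prop :=
  forall c : chart_index S,
    smooth_on (chart c @` chart_dom c) (g \o chart_inv c).

Definition smooth_oneform (R : realType) (N : nat) (M : topologicalType)
    (S : smooth_atlas R N M) (b : chart_index S -> M -> 'rV[R]_N) : Prop :=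
  (forall c d x, chart_dom c x -> chart_dom d x ->
     b c x = b d x *m (transition_partials c d x)^T) /\
  (forall c i, smooth_on (chart c @` chart_dom c)
                         (fun u => b c (chart_inv c u) 0 i)).

(* Symmetric, of signature (+,-,...,-). *)
Definition lorentzian (R : realType) (N : nat) (a : 'M[R]_N) : Prop :=
  a^T = a /\
  exists2 P : 'M[R]_N, P \in unitmx &
    P *m a *m P^T = diag_mx (\row_i (if val i == 0%N then 1 else -1)).

Definition smooth_metric (R : realType) (N : nat) (M : topologicalType)
    (S : smooth_atlas R N M) (a : chart_index S -> M -> 'M[R]_N) : Prop :=
  [/\ forall c x, chart_dom c x -> lorentzian (a c x),
      forall c d x, chart_dom c x -> chart_dom d x ->
        a c x = transition_partials c d x *m a d x
                  *m (transition_partials c d x)^T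
    & forall c i j, smooth_on (chart c @` chart_dom c)
                              (fun u => a c (chart_inv c u) i j)].

(* The nonnegative real with hyperbolic cosine t; meaningful for 1 <= t. *)
Definition arccosh (R : realType) (t : R) : R :=
  get [set s | 0 <= s /\ (expR s + expR (- s)) / 2 = t].

(* The values epsilon = 1 and epsilon = -1. *)
Inductive sector := timelike | spacelike.

Definition scalar_product (R : realType) (N : nat) (a : 'M[R]_N)
    (y z : 'rV[R]_N) : R := \sum_i \sum_j a i j * y 0 i * z 0 j.

Section Pointwise.
Context (R : realType) (N : nat) (a : 'M[R]_N) (b : 'rV[R]_N) (g : R).
Implicit Types (s : sector) (y : 'rV[R]_N).

Definition b_up : 'rV[R]_N := \row_i \sum_j invmx a i j * b 0 j.

Definition b_norm2 : R := \sum_i \sum_j invmx a i j * b 0 i * b 0 j.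

Definition b_of y : R := \sum_i b 0 i * y 0 i.

Definition r_mx : 'M[R]_N := \matrix_(i, j) (a i j + b 0 i * b 0 j).

Definition gamma_of y : R := scalar_product r_mx y y.

Definition q_of y : R := Num.sqrt `|gamma_of y|.

Definition B_of y : R :=
  gamma_of y - g * b_of y * q_of y - b_of y ^+ 2.

Definition A_of y : R := b_of y + g / 2 * q_of y.

Definition timelike_region : set 'rV[R]_N :=
  [set y | 0 < gamma_of y /\ 0 < B_of y].

(* Either of the components may be the one called future. *)
Definition is_future_sector (C : set 'rV[R]_N) : Prop :=
  exists2 y0, timelike_region y0 & C = connected_component timelike_region y0.

Definition spacelike_sector : set 'rV[R]_N := [set y | gamma_of y < 0].

Definition h_of s : R :=
  match s with
  | timelike => Num.sqrt (1 + g ^+ 2 / 4)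
  | spacelike => Num.sqrt (1 - g ^+ 2 / 4)
  end.

Definition G_of s : R := g / h_of s.

Definition g_plus : R := - (g / 2) + h_of timelike.
Definition g_minus : R := - (g / 2) - h_of timelike.

Definition L_of y : R := q_of y + g / 2 * b_of y.

Definition f_of y : R :=
  let G := G_of spacelike in
  let t := atan (L_of y / (h_of spacelike * b_of y)) in
  if b_of y < 0 then - atan (G / 2) + t
  else if 0 < b_of y then - pi - atan (G / 2) + t
  else - (pi / 2) - atan (G / 2).

Definition J_of s y : R :=
  match s with
  | timelike =>
      ((b_of y - g_minus * q_of y) / (g_plus * q_of y - b_of y))
        `^ (- (G_of timelike / 4))
  | spacelike => expR (- (G_of spacelike / 2 * f_of y))
  end.

Definition F2_of s y : R := B_of y * J_of s y ^+ 2.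

Definition varkappa s y : R :=
  (h_of s)^-1 * `|F2_of s y| `^ ((1 - h_of s) / 2).

Definition v_of y : 'rV[R]_N := y + b_of y *: b_up.

Definition zeta s y : 'rV[R]_N :=
  (J_of s y / (varkappa s y * h_of s)) *:
    (h_of s *: v_of y - (b_of y + g / 2 * q_of y) *: b_up).

Definition alpha_arg s y1 y2 : R :=
  let r12 := scalar_product r_mx y1 y2 in
  let D := Num.sqrt `|B_of y1| * Num.sqrt `|B_of y2| in
  match s with
  | timelike => (h_of s ^+ 2 * r12 - A_of y1 * A_of y2) / D
  | spacelike => (A_of y1 * A_of y2 - h_of s ^+ 2 * r12) / D
  end.

Definition alpha s y1 y2 : R :=
  match s with
  | timelike => (h_of s)^-1 * arccosh (alpha_arg s y1 y2)
  | spacelike => (h_of s)^-1 * acos (alpha_arg s y1 y2)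
  end.

Definition S2 (z : 'rV[R]_N) : R := scalar_product a z z.

Definition alpha_pR_arg s (z1 z2 : 'rV[R]_N) : R :=
  match s with
  | timelike =>
      scalar_product a z1 z2 / (Num.sqrt (S2 z1) * Num.sqrt (S2 z2))
  | spacelike =>
      - scalar_product a z1 z2 / (Num.sqrt `|S2 z1| * Num.sqrt `|S2 z2|)
  end.

Definition alpha_pR s (z1 z2 : 'rV[R]_N) : R :=
  match s with
  | timelike => arccosh (alpha_pR_arg s z1 z2)
  | spacelike => acos (alpha_pR_arg s z1 z2)
  end.

End Pointwise.

(* Main.v *)
Require Import Defs.
From HB Require Import structures.
From mathcomp Require Import all_boot all_order all_algebra.
From mathcomp Require Import all_classical all_reals all_analysis.
From mathcomp Require Import ring lra.
Set Implicit Arguments.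
Unset Strict Implicit.
Unset Printing Implicit Defensive.
Import Order.TTheory GRing.Theory Num.Theory.
Import numFieldNormedType.Exports.
Local Open Scope classical_set_scope.
Local Open Scope ring_scope.

(** Write u for b with its index raised, so a(u, u) = -1 and v is orthogonal to u.
    Then zeta is a positive multiple of w = h v - A u, and
      a(w1, w2) = h^2 r(y1, y2) - A1 A2,   a(w, w) = B,
    so the positive factors cancel and both angles have the same argument.
    In the time-like case the argument is at least 1 by the reverse
    Cauchy-Schwarz inequality, once a(w1, w2) > 0: this product is positive at
    y2 = y1 and cannot vanish as y2 moves in the connected future sector. *)

(** * Continuity of sums, products and composites *)

Section ContinuousRealFunctions.
Context (R : realType) (T : topologicalType).
Implicit Types f k : T -> R.

Lemma continuous_addr f k :
  continuous f -> continuous k -> continuous (fun x => f x + k x).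
Proof. by move=> cf ck x; apply: cvgD; [exact: cf|exact: ck]. Qed.

Lemma continuous_mulr f k :
  continuous f -> continuous k -> continuous (fun x => f x * k x).
Proof. by move=> cf ck x; apply: cvgM; [exact: cf|exact: ck]. Qed.

Lemma continuous_comp_all f (k : R -> R) :
  continuous f -> continuous k -> continuous (fun x => k (f x)).
Proof. by move=> cf ck x; apply: continuous_comp; [exact: cf|exact: ck]. Qed.

Lemma continuous_sumr (I : Type) (r : seq I) (F : I -> T -> R) :
  (forall i, continuous (F i)) -> continuous (fun x => \sum_(i <- r) F i x).
Proof.
move=> cF; apply: (@continuous_big R I +%R 0 xpredT _ T r F) => [|i _].
  by move=> z; apply: cvgD; [exact: cvg_fst|exact: cvg_snd].
exact: cF.
Qed.

End ContinuousRealFunctions.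

(** Extracts the factor of [zeta] from the norms; [k * (k * t)] is the shape that bilinearity in
    each argument produces. *)
Lemma sqrtr_scale (R : realType) (k t : R) :
  0 < k -> Num.sqrt (k * (k * t)) = k * Num.sqrt t.
Proof.
by move=> k0; rewrite mulrA -expr2 sqrtrM ?sqr_ge0// sqrtr_sqr gtr0_norm.
Qed.

(** * Bilinearity of the scalar product *)

Section ScalarProduct.
Context (R : realType) (N : nat) (a : 'M[R]_N).
Implicit Types y z w : 'rV[R]_N.

Lemma scalar_productE y z : scalar_product a y z = (y *m a *m z^T) 0 0.
Proof.
rewrite !mxE /scalar_product exchange_big; apply: eq_bigr => j _.
by rewrite !mxE mulr_suml; apply: eq_bigr => i _; rewrite (mulrC (a i j)).
Qed.

Lemma scalar_productDl y1 y2 z :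
  scalar_product a (y1 + y2) z = scalar_product a y1 z + scalar_product a y2 z.
Proof. by rewrite !scalar_productE !mulmxDl mxE. Qed.

Lemma scalar_productZl k y z :
  scalar_product a (k *: y) z = k * scalar_product a y z.
Proof. by rewrite !scalar_productE -!scalemxAl mxE. Qed.

Lemma scalar_productC y z : a^T = a ->
  scalar_product a y z = scalar_product a z y.
Proof.
move=> aT; rewrite !scalar_productE.
have <- : (y *m a *m z^T)^T 0 0 = (y *m a *m z^T) 0 0 by rewrite mxE.
by rewrite !trmx_mul trmxK aT mulmxA.
Qed.

End ScalarProduct.

(** * Forms of signature (+,-,...,-) *)

Section Lorentzian.
Context (R : realType) (N : nat) (a : 'M[R]_N).
Hypothesis La : lorentzian a.
Implicit Types y z w : 'rV[R]_N.

Let aT : a^T = a. Proof. by case: La. Qed.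

Lemma scalar_productDr y z1 z2 :
  scalar_product a y (z1 + z2) = scalar_product a y z1 + scalar_product a y z2.
Proof. by rewrite !(scalar_productC y) ?aT// scalar_productDl. Qed.

Lemma scalar_productZr k y z :
  scalar_product a y (k *: z) = k * scalar_product a y z.
Proof. by rewrite !(scalar_productC y) ?aT// scalar_productZl. Qed.

(** The diagonal matrix of signs squares to 1, so it is invertible, and hence so is each factor of
    [P *m a *m P^T]. *)
Lemma lorentzian_unit : a \in unitmx.
Proof.
case: La => _ [P _ e].
set d := \row_i _ in e.
have dd : diag_mx d *m diag_mx d = 1%:M.
  rewrite mulmx_diag -diag_const_mx; congr diag_mx; apply/rowP => i.
  by rewrite !mxE; case: ifP => _; rewrite ?mulr1 ?mulrNN ?mulr1.
have : P *m a *m P^T \in unitmx by rewrite e; case: (mulmx1_unit dd).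
by rewrite !unitmx_mul => /andP[/andP[]].
Qed.

(** Take for [l] the functional reading off the one coordinate with sign + in the diagonalizing
    frame; on its kernel only negative squares remain. *)
Lemma lorentzian_hyperplane : exists l : 'cV[R]_N,
  forall w, w *m l = 0 -> S2 a w <= 0.
Proof.
case: N a La => [a0 _|n a0 [_ [P Pu e]]].
  by exists 0 => w _; rewrite /S2 /scalar_product big_ord0.
exists (col 0 (invmx P)) => w wl.
(* The row [w *m invmx P] holds the coordinates of [w] in the basis formed by the rows of [P]. *)
have -> : S2 a0 w = \sum_i (if val i == 0%N then 1 else -1) *
    (w *m invmx P) 0 i ^+ 2.
  rewrite /S2 scalar_productE.
  have -> : w *m a0 *m w^T =
      (w *m invmx P) *m (P *m a0 *m P^T) *m (w *m invmx P)^T.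
    rewrite -!mulmxA mulKmx// -trmx_mul; congr (_ *m _); congr (_ *m _).
    by rewrite mulmxKV.
  rewrite e mul_mx_diag mxE; apply: eq_bigr => i _.
  by rewrite !mxE; case: ifP => _; ring.
rewrite big_ord_recl /=.
have -> : (w *m invmx P) 0 ord0 = 0.
  by move/matrixP: wl => /(_ 0 0); rewrite colE mulmxA -colE !mxE.
rewrite expr0n mulr0 add0r; apply: sumr_le0 => i _.
by rewrite mulN1r oppr_le0 sqr_ge0.
Qed.

(* Some combination [w1 - t w2] lies in the hyperplane on which [a] is negative
   semidefinite; this bounds the discriminant of [t |-> S2 (w1 - t w2)]. *)
Lemma reverse_cauchy_schwarz w1 w2 : 0 < S2 a w1 -> 0 < S2 a w2 ->
  S2 a w1 * S2 a w2 <= scalar_product a w1 w2 ^+ 2.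
Proof.
have [l lP] := lorentzian_hyperplane => w1p w2p.
have l2 : (w2 *m l) 0 0 != 0.
  apply/negP => /eqP l20.
  have : w2 *m l = 0 by apply/matrixP => i j; rewrite !ord1 l20 mxE.
  by move/lP; rewrite leNgt w2p.
pose t := (w1 *m l) 0 0 / (w2 *m l) 0 0.
have : (w1 + (- t) *: w2) *m l = 0.
  apply/matrixP => i j; rewrite !ord1 mulmxDl -scalemxAl !mxE.
  move: l2; rewrite /t !mxE => l2; field; exact: l2.
move/lP; move: w1p w2p; rewrite /S2.
rewrite !(scalar_productDl, scalar_productDr, scalar_productZl, scalar_productZr).
rewrite (scalar_productC w2 w1)//.
set p := scalar_product a w1 w1; set r := scalar_product a w2 w2.
set s := scalar_product a w1 w2 => p0 r0 H.
(* Completing the square: r S2(w1 - t w2) = p r - s^2 + (t r - s)^2. *)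
have := mulr_ge0_le0 (ltW r0) H.
have := sqr_ge0 (t * r - s).
lra.
Qed.

End Lorentzian.

(** * The map [zeta] in one tangent space *)

Section Fibre.
Context (R : realType) (N : nat) (a : 'M[R]_N) (b : 'rV[R]_N) (g : R).
Hypotheses (La : lorentzian a) (b1 : b_norm2 a b = -1).
Implicit Types (s : sector) (y : 'rV[R]_N).

Let aT : a^T = a. Proof. by case: La. Qed.

Let au : a \in unitmx. Proof. exact: lorentzian_unit. Qed.

Let u := b_up a b.

Lemma b_upE : b_up a b = b *m invmx a.
Proof.
apply/rowP => i; rewrite !mxE; apply: eq_bigr => j _.
by rewrite -{1}aT -trmx_inv mxE mulrC.
Qed.

Lemma b_ofE y : scalar_product a u y = b_of b y.
Proof.
rewrite scalar_productE /u b_upE mulmxKV// mxE; apply: eq_bigr => i _.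
by rewrite mxE.
Qed.

Lemma scalar_product_b_up : scalar_product a u u = -1.
Proof.
rewrite -b1 (_ : b_norm2 a b = scalar_product (invmx a) b b)//.
by rewrite !scalar_productE /u b_upE mulmxKV// trmx_mul trmx_inv aT mulmxA.
Qed.

Lemma scalar_product_r_mx y z :
  scalar_product (r_mx a b) y z = scalar_product a y z + b_of b y * b_of b z.
Proof.
rewrite /scalar_product /b_of mulr_suml -big_split; apply: eq_bigr => i _ /=.
rewrite mulr_sumr -big_split; apply: eq_bigr => j _ /=.
by rewrite !mxE; ring.
Qed.

(* [zeta] stripped of its positive scalar factor. *)
Definition zeta_dir s y : 'rV[R]_N := h_of g s *: v_of a b y - A_of a b g y *: u.

(** With v = y + b u one has a(v, u) = 0 and a(v1, v2) = r(y1, y2), so the cross terms vanish; the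
    minus sign is a(u, u) = -1. *)
Lemma scalar_product_zeta_dir s y z :
  scalar_product a (zeta_dir s y) (zeta_dir s z)
  = h_of g s ^+ 2 * scalar_product (r_mx a b) y z - A_of a b g y * A_of a b g z.
Proof.
rewrite scalar_product_r_mx /zeta_dir /v_of -/u -!(scaleNr _ u).
rewrite !(scalar_productDl, scalar_productDr, scalar_productZl, scalar_productZr)//.
rewrite (scalar_productC y u)// !b_ofE.
have := scalar_product_b_up; rewrite b_ofE => ->; ring.
Qed.

Lemma h_of_timelike_sqr : h_of g timelike ^+ 2 = 1 + g ^+ 2 / 4.
Proof. by rewrite sqr_sqrtr//; have := sqr_ge0 g; lra. Qed.

(** Here (h^2 - 1) gamma = g^2 q^2 / 4, which cancels the last term of A^2. In the space-like sector
    both h^2 - 1 and gamma change sign in terms of g^2 and q^2, so the same cancellation occurs. *)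
Lemma S2_zeta_dir_timelike y : 0 < gamma_of a b y ->
  S2 a (zeta_dir timelike y) = B_of a b g y.
Proof.
move=> y0; rewrite /S2 scalar_product_zeta_dir -/(gamma_of a b y).
have : q_of a b y ^+ 2 = gamma_of a b y.
  by rewrite sqr_sqrtr ?normr_ge0 // gtr0_norm.
by rewrite h_of_timelike_sqr /B_of /A_of => <-; field.
Qed.

Lemma h_of_spacelike_sqr : -2 < g < 2 -> h_of g spacelike ^+ 2 = 1 - g ^+ 2 / 4.
Proof. by move=> g2; rewrite sqr_sqrtr//; nra. Qed.

Lemma S2_zeta_dir_spacelike y : -2 < g < 2 -> gamma_of a b y < 0 ->
  S2 a (zeta_dir spacelike y) = B_of a b g y.
Proof.
move=> g2 y0; rewrite /S2 scalar_product_zeta_dir -/(gamma_of a b y).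
have : q_of a b y ^+ 2 = - gamma_of a b y.
  by rewrite sqr_sqrtr ?normr_ge0 // ltr0_norm.
rewrite h_of_spacelike_sqr// /B_of /A_of => /eqP; rewrite -eqr_oppLR => /eqP <-.
by field.
Qed.

(** Completing the square gives -B = A^2 + h^2 q^2, where h^2 > 0 because |g| < 2. *)
Lemma B_of_lt0 y : -2 < g < 2 -> gamma_of a b y < 0 -> B_of a b g y < 0.
Proof.
move=> g2 y0.
have : q_of a b y ^+ 2 = - gamma_of a b y.
  by rewrite sqr_sqrtr ?normr_ge0 // ltr0_norm.
rewrite /B_of; set q := q_of _ _ _; set t := b_of _ _ => e.
have -> : gamma_of a b y - g * t * q - t ^+ 2
  = - ((t + g / 2 * q) ^+ 2 + q ^+ 2 * (1 - g ^+ 2 / 4)).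
  by rewrite -[gamma_of a b y]opprK -e; field.
rewrite oppr_lt0 ltr_wpDl ?sqr_ge0// mulr_gt0//; last nra.
by rewrite e oppr_gt0.
Qed.

(** * Positivity of the scalar factor of [zeta] *)

Lemma zetaE s y : zeta a b g s y
  = (J_of a b g s y / (varkappa a b g s y * h_of g s)) *: zeta_dir s y.
Proof. by []. Qed.

(** The numerator m and denominator p of the base have product B > 0 and sum 2 h q >= 0, so both are
    positive and the real power has a positive base. *)
Lemma J_of_timelike_gt0 y : 0 < gamma_of a b y -> 0 < B_of a b g y ->
  0 < J_of a b g timelike y.
Proof.
move=> y0 B0.
have e : q_of a b y ^+ 2 = gamma_of a b y.
  by rewrite sqr_sqrtr ?normr_ge0 // gtr0_norm.
rewrite /J_of; apply: powR_gt0.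
set m := b_of b y - _; set p := _ - b_of b y.
have : 0 < m * p.
  have -> : m * p = B_of a b g y.
    rewrite /m /p /B_of /g_minus /g_plus -e.
    have := h_of_timelike_sqr; set h := h_of g timelike => hE.
    (* The coefficient of q^2 is -(g_+ g_-) = h^2 - g^2 / 4 = 1. *)
    transitivity ((h ^+ 2 - g ^+ 2 / 4) * q_of a b y ^+ 2
      - g * b_of b y * q_of a b y - b_of b y ^+ 2); first by field.
    by rewrite hE; field.
  by [].
have : 0 <= m + p.
  have -> : m + p = 2 * h_of g timelike * q_of a b y.
    by rewrite /m /p /g_minus /g_plus; ring.
  by rewrite mulr_ge0 ?mulr_ge0 ?sqrtr_ge0.
move=> mp0 mp; have [m0|m0] := ltP 0 m; first by rewrite divr_gt0// -(pmulr_rgt0 _ m0).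
by nra.
Qed.

Lemma h_of_timelike_gt0 : 0 < h_of g timelike.
Proof. by rewrite sqrtr_gt0; have := sqr_ge0 g; lra. Qed.

Lemma h_of_spacelike_gt0 : -2 < g < 2 -> 0 < h_of g spacelike.
Proof. by move=> g2; rewrite sqrtr_gt0; nra. Qed.

(** Since B and J are nonzero, so is F^2 = B J^2; the power in [varkappa] then has a positive base,
    and [varkappa] is positive. *)
Lemma zeta_pos_scale s y : 0 < h_of g s -> 0 < J_of a b g s y ->
  B_of a b g y != 0 ->
  exists2 k, 0 < k & zeta a b g s y = k *: zeta_dir s y.
Proof.
move=> h0 J0 B0; rewrite zetaE; eexists; last by [].
by rewrite divr_gt0// mulr_gt0// /varkappa mulr_gt0 ?invr_gt0// powR_gt0//
  normr_gt0 mulf_neq0// expf_neq0// gt_eqF.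
Qed.

(** * Continuity and the sign of the product on the future sector *)

Lemma continuous_scalar_product_diag (m : 'M[R]_N) :
  continuous (fun y : 'rV[R]_N => scalar_product m y y).
Proof.
apply: continuous_sumr => i; apply: continuous_sumr => j.
apply: continuous_mulr; last exact: coord_continuous.
by apply: continuous_mulr; [exact: cst_continuous|exact: coord_continuous].
Qed.

Lemma continuous_scalar_product (m : 'M[R]_N) (y0 : 'rV[R]_N) :
  continuous (scalar_product m y0).
Proof.
apply: continuous_sumr => i; apply: continuous_sumr => j.
by apply: continuous_mulr; [exact: cst_continuous|exact: coord_continuous].
Qed.

Lemma continuous_A_of : continuous (A_of a b g).
Proof.
apply: continuous_addr.
  apply: continuous_sumr => i.
  by apply: continuous_mulr; [exact: cst_continuous|exact: coord_continuous].
apply: continuous_mulr; first exact: cst_continuous.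
apply: (continuous_comp_all (k := @Num.sqrt R)); last exact: sqrt_continuous.
apply: (continuous_comp_all (k := @Num.norm R R)); last exact: norm_continuous.
exact: continuous_scalar_product_diag.
Qed.

Lemma continuous_zeta_dir_product s y0 :
  continuous (fun y => scalar_product a (zeta_dir s y0) (zeta_dir s y)).
Proof.
under eq_fun do rewrite scalar_product_zeta_dir -mulNr.
apply: continuous_addr; apply: continuous_mulr; try exact: cst_continuous.
  exact: continuous_scalar_product.
exact: continuous_A_of.
Qed.

Lemma timelike_region_S2_gt0 y : timelike_region a b g y ->
  0 < S2 a (zeta_dir timelike y).
Proof. by case=> y0 B0; rewrite S2_zeta_dir_timelike. Qed.

(* The product never vanishes on the region, by the reverse Cauchy-Schwarz
   inequality, so its sign is constant on a connected component. *)
Lemma future_sector_product_gt0 C y1 y2 :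
  is_future_sector a b g C -> C y1 -> C y2 ->
  0 < scalar_product a (zeta_dir timelike y1) (zeta_dir timelike y2).
Proof.
move=> [y0 _ ->] C1 C2.
set D := connected_component _ _ in C1 C2.
pose phi y := scalar_product a (zeta_dir timelike y1) (zeta_dir timelike y).
have DS y : D y -> 0 < S2 a (zeta_dir timelike y).
  by move/connected_component_sub; exact: timelike_region_S2_gt0.
have /connected_intervalP itv : connected [set phi y | y in D].
  apply: connected_continuous_connected; first exact: component_connected.
  apply: continuous_subspaceT; exact: continuous_zeta_dir_product.
rewrite ltNge; apply/negP => le0.
(* The image is an interval containing [phi y2 <= 0] and [phi y1 > 0]. *)
have [y Dy phiy] : [set phi y | y in D] 0.
  apply: (itv (phi y2) (phi y1)); [by exists y2|by exists y1|].
  by rewrite le0 ltW// DS.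
have := reverse_cauchy_schwarz La (DS _ C1) (DS _ Dy).
rewrite -/(phi y) phiy expr0n /= leNgt mulr_gt0 ?DS//.
Qed.

(** * Comparison of the two angle arguments *)

Lemma alpha_arg_timelikeE y1 y2 :
  timelike_region a b g y1 -> timelike_region a b g y2 ->
  alpha_pR_arg a timelike (zeta a b g timelike y1) (zeta a b g timelike y2)
  = alpha_arg a b g timelike y1 y2.
Proof.
move=> t1 t2; have [g1 B1] := t1; have [g2 B2] := t2.
have [k1 k10 ->] := zeta_pos_scale h_of_timelike_gt0
  (J_of_timelike_gt0 g1 B1) (lt0r_neq0 B1).
have [k2 k20 ->] := zeta_pos_scale h_of_timelike_gt0
  (J_of_timelike_gt0 g2 B2) (lt0r_neq0 B2).
rewrite /alpha_arg /alpha_pR_arg -scalar_product_zeta_dir /S2.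
rewrite !(scalar_productZl, scalar_productZr)//.
rewrite -!/(S2 _ _) !S2_zeta_dir_timelike// !sqrtr_scale// !gtr0_norm//.
have : Num.sqrt (B_of a b g y1) != 0 by rewrite gt_eqF// sqrtr_gt0.
have : Num.sqrt (B_of a b g y2) != 0 by rewrite gt_eqF// sqrtr_gt0.
by move=> s1 s2; field; rewrite s1 s2 !gt_eqF.
Qed.

Lemma alpha_arg_spacelikeE y1 y2 : -2 < g < 2 ->
  gamma_of a b y1 < 0 -> gamma_of a b y2 < 0 ->
  alpha_pR_arg a spacelike (zeta a b g spacelike y1) (zeta a b g spacelike y2)
  = alpha_arg a b g spacelike y1 y2.
Proof.
move=> g2 y10 y20.
have B1 := B_of_lt0 g2 y10; have B2 := B_of_lt0 g2 y20.
(* [J_of] is an exponential here, hence positive on every branch of [f_of]. *)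
have J0 y : 0 < J_of a b g spacelike y by exact: expR_gt0.
have [k1 k10 ->] := zeta_pos_scale (h_of_spacelike_gt0 g2) (J0 y1) (ltr0_neq0 B1).
have [k2 k20 ->] := zeta_pos_scale (h_of_spacelike_gt0 g2) (J0 y2) (ltr0_neq0 B2).
rewrite /alpha_arg /alpha_pR_arg -[A_of _ _ _ _ * _ - _]opprB.
rewrite -scalar_product_zeta_dir /S2.
rewrite !(scalar_productZl, scalar_productZr)//.
rewrite -!/(S2 _ _) !S2_zeta_dir_spacelike//.
rewrite !normrM !(gtr0_norm k10) !(gtr0_norm k20) !sqrtr_scale//.
have : Num.sqrt `|B_of a b g y1| != 0.
  by rewrite gt_eqF// sqrtr_gt0 normr_gt0 ltr0_neq0.
have : Num.sqrt `|B_of a b g y2| != 0.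
  by rewrite gt_eqF// sqrtr_gt0 normr_gt0 ltr0_neq0.
by move=> s1 s2; field; rewrite s1 s2 !gt_eqF.
Qed.

(** Guarantees that the quotient in [alpha_pR_arg] is a genuine one, not the default value of
    division by zero. *)
Lemma S2_zeta_spacelike_neq0 y : -2 < g < 2 -> gamma_of a b y < 0 ->
  S2 a (zeta a b g spacelike y) != 0.
Proof.
move=> g2 y0; have B0 := B_of_lt0 g2 y0.
have [k k0 ->] := zeta_pos_scale (h_of_spacelike_gt0 g2)
  (expR_gt0 _ : 0 < J_of a b g spacelike y) (ltr0_neq0 B0).
rewrite /S2 !(scalar_productZl, scalar_productZr)// -/(S2 _ _).
by rewrite S2_zeta_dir_spacelike// !mulf_neq0 ?(gt_eqF k0) ?(lt_eqF B0).
Qed.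

(** Places the argument where [arccosh] is meaningful: take square roots in the reverse
    Cauchy-Schwarz inequality, the product being positive on the sector. *)
Lemma alpha_arg_timelike_ge1 C y1 y2 :
  is_future_sector a b g C -> C y1 -> C y2 ->
  1 <= alpha_arg a b g timelike y1 y2.
Proof.
move=> CF C1 C2.
have p0 := future_sector_product_gt0 CF C1 C2.
case: CF C1 C2 => [y0 _ ->] /connected_component_sub t1 /connected_component_sub t2.
have [g1 B1] := t1; have [g2 B2] := t2.
have := reverse_cauchy_schwarz La (timelike_region_S2_gt0 t1)
  (timelike_region_S2_gt0 t2).
rewrite !S2_zeta_dir_timelike// => rcs.
rewrite /alpha_arg -scalar_product_zeta_dir !gtr0_norm//.
rewrite ler_pdivlMr ?mulr_gt0 ?sqrtr_gt0// mul1r.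
rewrite -sqrtrM ?(ltW B1)// -(ger0_norm (ltW p0)) -sqrtr_sqr.
exact: ler_wsqrtr.
Qed.

End Fibre.

(** * The angle formula at a point of the manifold *)

Theorem mainTheorem9 (R : realType) (N : nat) (M : topologicalType)
    (hausdorffM : hausdorff_space M) (countableM : @second_countable M)
    (S : smooth_atlas R N M)
    (a : chart_index S -> M -> 'M[R]_N) (smooth_a : smooth_metric a)
    (b : chart_index S -> M -> 'rV[R]_N) (smooth_b : smooth_oneform b)
    (g : M -> R) (smooth_g : smooth_scalar S g)
    (norm_b : forall c x, chart_dom c x -> b_norm2 (a c x) (b c x) = -1)
    (c : chart_index S) (x : M) (cx : chart_dom c x) (y1 y2 : 'rV[R]_N) :
  let ax := a c x in let bx := b c x in let gx := g x in
  (forall future : set 'rV[R]_N, is_future_sector ax bx gx future ->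
     future y1 -> future y2 ->
     let z1 := zeta ax bx gx timelike y1 in
     let z2 := zeta ax bx gx timelike y2 in
     [/\ 1 <= alpha_arg ax bx gx timelike y1 y2,
         1 <= alpha_pR_arg ax timelike z1 z2
       & alpha ax bx gx timelike y1 y2
         = (h_of gx timelike)^-1 * alpha_pR ax timelike z1 z2]) /\
  (-2 < gx < 2 ->
     spacelike_sector ax bx y1 -> spacelike_sector ax bx y2 ->
     -1 <= alpha_arg ax bx gx spacelike y1 y2 <= 1 ->
     let z1 := zeta ax bx gx spacelike y1 in
     let z2 := zeta ax bx gx spacelike y2 in
     [/\ S2 ax z1 != 0 /\ S2 ax z2 != 0,
         -1 <= alpha_pR_arg ax spacelike z1 z2 <= 1
       & alpha ax bx gx spacelike y1 y2
         = (h_of gx spacelike)^-1 * alpha_pR ax spacelike z1 z2]).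
Proof.
move=> ax bx gx.
(* In the chart [c] at [x] the claim becomes linear algebra in one tangent space. *)
have La : lorentzian ax by case: smooth_a => /(_ _ _ cx).
have bn : b_norm2 ax bx = -1 by exact: norm_b.
split=> [C CF C1 C2 z1 z2|g2 s1 s2 arg12 z1 z2].
  have ge1 := alpha_arg_timelike_ge1 La bn CF C1 C2.
  case: CF C1 C2 => [y0 _ ->] /connected_component_sub t1 /connected_component_sub t2.
  have e := alpha_arg_timelikeE La bn t1 t2.
  by split; rewrite /alpha /alpha_pR ?e.
have e := alpha_arg_spacelikeE La bn g2 s1 s2.
split; rewrite /alpha /alpha_pR ?e//.
by split; exact: S2_zeta_spacelike_neq0.
Qed.
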